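(* Let $\ell\in(0,1]$, $\alpha\in(0,1]$, $\ell_\alpha=1-\alpha+\alpha\ell$ and $r=\alpha\ell/\ell_\alpha$. Let $(B_i)_{i\ge1}$ and $(D_i)_{i\ge1}$ be two mutually independent i.i.d. sequences with $B_i\sim\mathrm{Bernoulli}(\alpha)$ and $D_i\sim\mathrm{Bernoulli}(r)$, and let $X_n=B_1+\cdots+B_n$ and $Y_n=D_1+\cdots+D_n$ (with $X_0=Y_0=0$). Then, with $c_{m,n}$ as defined in the context, for all integers $0\le m\le n$, $$c_{m,n}=\ell_\alpha^{\,m}\,\mathbb P(X_n>Y_m)-\ell_\alpha^{\,n}\,\mathbb P(X_m>Y_n).$$
   Context: For integers $0\le m\le n$, $$c_{m,n}=\alpha\sum_{j=0}^{n-1}\sum_{k=0}^{m}\left[\binom{m}{k}\binom{n-1-j}{k}-\binom{n}{k}\binom{m-1-j}{k}\right](\alpha^2\ell)^k(1-\alpha)^{n+m-1-j-2k},$$ with the convention $\binom{a}{k}=0$ unless $0\le k\le a$, and $0^0=1$; the inner sum is restricted to $k\le\min\{m,n-1-j\}$ (the bracket vanishes for larger $k$). *)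

(* Defs.v *)
(* MathComp-Analysis. *)
From mathcomp Require Import all_boot all_order all_algebra finmap.
From mathcomp Require Import all_classical all_reals all_analysis.

Set Implicit Arguments.
Unset Strict Implicit.
Unset Printing Implicit Defensive.

Import Order.TTheory GRing.Theory Num.Theory.

Local Open Scope classical_set_scope.
Local Open Scope ring_scope.

(* The upper argument is an integer, because in [coef_c] it can be negative;
   truncated subtraction would give 'C(0, 0) = 1 there instead of 0. *)
Definition zbin (a : int) (k : nat) : nat :=
  if a is Posz b then 'C(b, k) else 0%N.

(* In the range of summation j <= n - 1 and k <= min (m, n - 1 - j), so neither
   truncated subtraction (in the bound on k and in the exponent) truncates. *)
Definition coef_c (R : nzRingType) (alpha l : R) (m n : nat) : R :=
  alpha * \sum_(0 <= j < n) \sum_(0 <= k < (minn m (n - 1 - j)).+1)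
    (((zbin m%:Z k)%:R * (zbin (n%:Z - 1 - j%:Z) k)%:R
      - (zbin n%:Z k)%:R * (zbin (m%:Z - 1 - j%:Z) k)%:R)
     * (alpha ^+ 2 * l) ^+ k * (1 - alpha) ^+ (n + m - 1 - j - 2 * k)).

Definition ell_alpha (R : nzRingType) (alpha l : R) : R :=
  1 - alpha + alpha * l.

Definition alpha_ratio (R : unitRingType) (alpha l : R) : R :=
  alpha * l / ell_alpha alpha l.

Definition independent_RVs d d' (T : measurableType d) (T' : measurableType d')
    (R : realType) (P : probability T R) (I : choiceType)
    (X : I -> {RV P >-> T'}) : Prop :=
  forall (J : {fset I}) (A : I -> set T'),
    (forall i, i \in J -> measurable (A i)) ->
    P (\bigcap_(i in [set` J]) (X i @^-1` A i))
      = (\prod_(i <- J) P (X i @^-1` A i))%E.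

Definition sigma_of d d' (T : measurableType d) (T' : measurableType d')
    (R : realType) (P : probability T R) (I : Type)
    (X : I -> {RV P >-> T'}) : set (set T) :=
  <<s \bigcup_i preimage_set_system setT (X i) measurable >>.

Definition independent_sequences d d' (T : measurableType d)
    (T' : measurableType d') (R : realType) (P : probability T R)
    (X Y : nat -> {RV P >-> T'}) : Prop :=
  forall E F : set T, sigma_of X E -> sigma_of Y F ->
    (P (E `&` F) = P E * P F)%E.

Definition iid_bernoulli d (T : measurableType d) (R : realType)
    (P : probability T R) (p : R) (X : nat -> {RV P >-> bool}) : Prop :=
  independent_RVs X /\
  forall i, distribution P (X i) =1 bernoulli_prob p.

(* Sequences are indexed from 0: [X i] is the (i+1)-st variable, so this is the
   sum of the first n variables; booleans are coerced to 0 or 1. *)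
Definition partial_sum d (T : measurableType d) (R : realType)
    (P : probability T R) (X : nat -> {RV P >-> bool}) (n : nat) (w : T) : nat :=
  (\sum_(i < n) X i w)%N.

(* Main.v *)
(* Decomposing X_n > k according to the trial that gives the (k+1)-st success,
     P(X_n > k) = alpha * sum_(t < n) P(X_t = k),
   while, since r = alpha l / l_alpha and 1 - r = (1 - alpha) / l_alpha,
     l_alpha^m P(Y_m = k) = C(m, k) (alpha l)^k (1 - alpha)^(m - k).
   Multiplying and summing over k and t = n - 1 - j gives l_alpha^m P(X_n > Y_m)
   as the first half of the double sum c_{m,n}; exchanging m and n gives the
   second half. *)
Require Import Defs.
From mathcomp Require Import all_boot all_order all_algebra finmap.
From mathcomp Require Import all_classical all_reals all_analysis.
From mathcomp Require Import zify ring lra.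

Set Implicit Arguments.
Unset Strict Implicit.
Unset Printing Implicit Defensive.

Import Order.TTheory GRing.Theory Num.Theory.

Local Open Scope classical_set_scope.
Local Open Scope ring_scope.

(** * The binomial law of the partial sums *)

Lemma probability_fintype (d : measure_display) (R : realType)
    (T : measurableType d) (P : probability T R) (I : finType)
    (f : T -> I) (Q : pred I) :
  (forall i, measurable (f @^-1` [set i])) ->
  P [set w | Q (f w)] = (\sum_(i | Q i) P (f @^-1` [set i]))%E.
Proof.
move=> mf.
have -> : [set w | Q (f w)] = \bigcup_(i in [set i | Q i]) (f @^-1` [set i]).
  apply/seteqP; split=> [w /= Qw|w [i /= Qi fwi]]; last by rewrite fwi.
  by exists (f w).
rewrite measure_fin_bigcup; [|exact: finite_finset| |by []]; last first.
  by move=> i j _ _ [w [/= <- <-]].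
rewrite -[RHS]big_filter [RHS]fsbig_seq ?filter_uniq ?index_enum_uniq//.
suff -> : [set` [seq i <- index_enum I | Q i]] = [set i | Q i] by [].
by apply/seteqP; split=> i /=; rewrite mem_filter mem_index_enum andbT.
Qed.

(** Pascal's rule, splitting on whether the last trial succeeds. *)
Lemma binomial_pmfSS (R : realType) (p : R) (n k : nat) :
  binomial_pmf n.+1 p k.+1 =
    p * binomial_pmf n p k + (1 - p) * binomial_pmf n p k.+1.
Proof.
rewrite /binomial_pmf /unstable.onem subSS binS mulrnDr addrC.
congr +%R; first by rewrite exprS -mulrA mulrnAr.
(* For [n <= k] the exponent [n - k.+1] truncates, but then its coefficient ['C(n, k.+1)] is 0. *)
have [lt_kn|le_nk] := ltnP k n; last first.
  by rewrite (@bin_small n k.+1) // !mulr0n mulr0.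
by rewrite mulrnAr mulrCA -exprS subnSK.
Qed.

(** The summand for [j] is the probability that trial j + 1 gives the (k+1)-st success. By induction
    on [n]: Pascal's rule shows that one more trial raises the tail by [p * binomial_pmf n p k]. *)
Lemma binomial_tail (R : realType) (p : R) (n k : nat) :
  \sum_(k.+1 <= i < n.+1) binomial_pmf n p i =
  p * \sum_(0 <= j < n) binomial_pmf j p k.
Proof.
elim: n => [|n IHn]; first by rewrite big_geq// big_nil mulr0.
rewrite [in RHS]big_nat_recr //= mulrDr -IHn big_add1 /=.
have [le_kn|lt_nk] := leqP k n; last first.
  rewrite (big_geq lt_nk) (big_geq (leqW lt_nk)) add0r.
  by rewrite /binomial_pmf bin_small // mulr0n mulr0.
under eq_bigr do rewrite binomial_pmfSS.
rewrite big_split /= -!mulr_sumr (@big_ltn _ _ _ k) // mulrDr.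
(* The shift only adds the index [n.+1], where the mass function of [n] trials is 0. *)
have -> : \sum_(k <= i < n.+1) binomial_pmf n p i.+1 =
    \sum_(k.+1 <= i < n.+1) binomial_pmf n p i.
  rewrite -(big_add1 _ _ k n.+2 predT (binomial_pmf n p)) big_nat_recr //=.
  by rewrite [X in _ + X]/binomial_pmf bin_small // mulr0n addr0.
ring.
Qed.

(** Independence gives each set [S] of successful trials the probability
    [p ^+ #|S| * (1 - p) ^+ (n - #|S|)], and ['C(n, k)] such sets have size [k]. *)
Lemma partial_sum_law d (T : measurableType d) (R : realType)
    (P : probability T R) (p : R) (X : nat -> {RV P >-> bool}) (n k : nat) :
  0 <= p <= 1 -> iid_bernoulli p X ->
  P [set w | partial_sum X n w = k] = (binomial_pmf n p k)%:E.
Proof.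
move=> p01 [indX lawX].
have PX i b : P (X i @^-1` [set b]) = (if b then p else 1 - p)%:E.
  have := lawX i [set b].
  rewrite bernoulli_probE // /distribution /pushforward => ->.
  rewrite !diracE !classical_sets.in_set1.
  by case: b; rewrite ?eqxx ?mule1 ?mule0 ?adde0 ?add0e.
pose f w : {set 'I_n} := [set i : 'I_n | X i w]%SET.
have Xf w : partial_sum X n w = #|f w|.
  rewrite /partial_sum -sum1_card [RHS]big_mkcond /=.
  by apply: eq_bigr => i _; rewrite inE; case: (X i w).
(* Independence is stated over finite sets of naturals, so the indicator of [S] is extended to
   [nat]; the default [false] occurs only for [i >= n]. *)
pose s (S : {set 'I_n}) i := oapp (fun j => j \in S) false (insub i).
have sE S (i : 'I_n) : s S i = (i \in S) by rewrite /s valK.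
have fE S : f @^-1` [set S] =
    \bigcap_(i in [set` fset_set `I_n]) (X i @^-1` [set s S i]).
  rewrite fset_setK //; apply/seteqP; split=> [w /= <- i /= lt_in|w /= Xw].
    by rewrite -[i]/(nat_of_ord (Ordinal lt_in)) sE inE.
  by apply/setP => i; rewrite inE -sE; apply: Xw => /=.
have mX S i : measurable (X i @^-1` [set s S i]) by exact: measurable_funPTI.
have Pf S : P (f @^-1` [set S]) = (p ^+ #|S| * (1 - p) ^+ (n - #|S|))%:E.
  rewrite fE indX // -fsbig_finite // -fsbig_ord.
  under eq_bigr do rewrite PX sE.
  rewrite prodEFin (bigID (mem S)) /=; congr (_ * _)%:E.
    by under eq_bigr => i Si do rewrite Si; rewrite prodr_const.
  under eq_bigr => i Si do rewrite (negbTE Si).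
  rewrite prodr_const; congr (_ ^+ _).
  by rewrite -[X in (X - _)%N](card_ord n) -(cardC (mem S)) addKn.
have -> : [set w | partial_sum X n w = k] = [set w | #|f w| == k].
  by apply/seteqP; split=> w /=; rewrite Xf => /eqP.
rewrite (probability_fintype _ (fun S : {set 'I_n} => #|S| == k)); last first.
  by move=> S; rewrite fE; apply: fin_bigcap_measurable.
under eq_bigr => S Sk do rewrite Pf (eqP Sk).
by rewrite sumEFin sumr_const -cardsE card_draws card_ord.
Qed.

(** * Measurability of the partial sums *)

(** [X] consists of plain functions so that the lemma applies to the given sigma-algebra and also to
    the one generated by the sequence. *)
Lemma measurable_sum_bool d (T : measurableType d) (X : nat -> T -> bool)
    (n : nat) (A : set nat) :
  (forall i b, measurable (X i @^-1` [set b])) ->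
  measurable ((fun w => (\sum_(i < n) X i w)%N) @^-1` A).
Proof.
move=> mX; elim: n A => [|n IHn] A.
  rewrite (_ : (fun w => _) = cst 0%N).
    by rewrite preimage_cst; case: ifP.
  by apply/funext => w; rewrite big_ord0.
have -> : (fun w => (\sum_(i < n.+1) X i w)%N) @^-1` A =
   (X n @^-1` [set true] `&`
     (fun w => (\sum_(i < n) X i w)%N) @^-1` (succn @^-1` A))
   `|` (X n @^-1` [set false] `&` (fun w => (\sum_(i < n) X i w)%N) @^-1` A).
  apply/seteqP; split=> w /=; rewrite big_ord_recr /=; case: (X n w) => /=;
    rewrite ?addn0 ?addn1; by [left|right|case=> -[]].
by apply: measurableU; apply: measurableI.
Qed.

(** This makes [independent_sequences] applicable to events about partial sums. *)
Lemma sigma_of_partial_sum d (T : measurableType d) (R : realType)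
    (P : probability T R) (X : nat -> {RV P >-> bool}) (n : nat) (A : set nat) :
  sigma_of X (partial_sum X n @^-1` A).
Proof.
apply: (@measurable_sum_bool _
  (g_sigma_algebraType
    (\bigcup_i preimage_set_system setT (X i) measurable)) X).
move=> i b; apply: sub_sigma_algebra; exists i => //.
by exists [set b] => //; rewrite setTI.
Qed.

(** * Algebra of the ratio and of the coefficients *)

Lemma alpha_ratio01 (R : realFieldType) (alpha l : R) :
  0 < l <= 1 -> 0 < alpha <= 1 -> 0 <= alpha_ratio alpha l <= 1.
Proof.
move=> /andP[l0 l1] /andP[a0 a1]; rewrite /alpha_ratio /ell_alpha.
have al0 : 0 < alpha * l by rewrite mulr_gt0.
have L0 : 0 < 1 - alpha + alpha * l by lra.
by rewrite ler_pdivlMr // mul0r ler_pdivrMr // mul1r; apply/andP; split; lra.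
Qed.

(** One factor [ell_alpha alpha l] goes to each of the [m] trials, turning the success weight into
    [alpha * l] and the failure weight into [1 - alpha]. *)
Lemma ell_alpha_binomial_pmf (R : realType) (alpha l : R) (m k : nat) :
  ell_alpha alpha l != 0 ->
  ell_alpha alpha l ^+ m * binomial_pmf m (alpha_ratio alpha l) k =
  (alpha * l) ^+ k * (1 - alpha) ^+ (m - k) *+ 'C(m, k).
Proof.
move=> L0; have [lt_mk|le_km] := ltnP m k.
  by rewrite /binomial_pmf bin_small // !mulr0n mulr0.
rewrite /binomial_pmf mulrnAr -{1}(subnKC le_km) exprD mulrACA -!exprMn.
have Lr : ell_alpha alpha l * alpha_ratio alpha l = alpha * l.
  by rewrite /alpha_ratio mulrCA divff // mulr1.
by rewrite /unstable.onem mulrBr mulr1 Lr /ell_alpha addrK.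
Qed.

(* The bound K on k is arbitrary as long as K > m: larger k contribute 0 since
   'C(m, k) = 0. *)
Definition half_coef (R : nzRingType) (alpha l : R) (m n K : nat) : R :=
  alpha * \sum_(0 <= j < n) \sum_(0 <= k < K)
    ('C(m, k)%:R * 'C(n - j.+1, k)%:R
     * (alpha ^+ 2 * l) ^+ k * (1 - alpha) ^+ (n + m - 1 - j - 2 * k)).

Lemma zbin_sub1 (a j k : nat) :
  zbin (a%:Z - 1 - j%:Z) k = if (j < a)%N then 'C(a - j.+1, k) else 0%N.
Proof.
have [lt_ja|le_aj] := ltnP j a.
  by have -> : a%:Z - 1 - j%:Z = (a - j.+1)%N%:Z by lia.
by have -> : a%:Z - 1 - j%:Z = Negz (j - a) by lia.
Qed.

(** Both halves are padded with zero terms to the common ranges [j < n] and [k < K], then compared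
    termwise. *)
Lemma coef_cE (R : comNzRingType) (alpha l : R) (m n K : nat) :
  (m <= n)%N -> (n < K)%N ->
  coef_c alpha l m n =
  half_coef alpha l m n K - half_coef alpha l n m K.
Proof.
move=> le_mn lt_nK; rewrite /coef_c /half_coef -mulrBr; congr (_ * _).
rewrite (@big_nat_widen _ _ _ 0%N m n) //.
rewrite (big_mkcond (fun j => j < m)%N) /= -sumrB.
apply: eq_big_nat => j /andP[_ lt_jn].
have leK : ((minn m (n - 1 - j)).+1 <= K)%N by lia.
rewrite (big_nat_widen _ _ _ _ _ leK) big_mkcond /=.
have -> : (if (j < m)%N then \sum_(0 <= k < K)
      'C(n, k)%:R * 'C(m - j.+1, k)%:R * (alpha ^+ 2 * l) ^+ k *
      (1 - alpha) ^+ (m + n - 1 - j - 2 * k) else 0) =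
    \sum_(0 <= k < K) 'C(n, k)%:R *
      (if (j < m)%N then 'C(m - j.+1, k) else 0)%:R *
      (alpha ^+ 2 * l) ^+ k * (1 - alpha) ^+ (n + m - 1 - j - 2 * k).
  rewrite addnC; case: ifP => // _.
  by rewrite big1 // => k _; rewrite mulr0 !mul0r.
rewrite -sumrB; apply: eq_big_nat => k _.
rewrite !zbin_sub1 lt_jn /= -!mulrBl.
rewrite -!natrM; case: ltnP => // lt_k.
(* Here [k] exceeds min(m, n - 1 - j), which is at least m - 1 - j since [m <= n]; so both products
   vanish. *)
have -> : ('C(m, k) * 'C(n - j.+1, k) = 0)%N.
  have [lt_mk|le_km] := ltnP m k; first by rewrite bin_small.
  by rewrite (@bin_small (n - j.+1)) ?muln0 //; lia.
have -> : ((if (j < m)%N then 'C(m - j.+1, k) else 0) = 0)%N.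
  by case: ifP => // lt_jm; rewrite bin_small //; lia.
by rewrite muln0 subrr !mul0r.
Qed.

(** * The probability that one partial sum exceeds the other *)

Lemma partial_sum_le d (T : measurableType d) (R : realType)
    (P : probability T R) (X : nat -> {RV P >-> bool}) (n : nat) (w : T) :
  (partial_sum X n w <= n)%N.
Proof.
rewrite -[leqRHS]card_ord -sum1_card /partial_sum.
by apply: leq_sum => i _; case: (X i w).
Qed.

Lemma partial_sum_gt d (T : measurableType d) (R : realType)
    (P : probability T R) (l alpha : R) (B D : nat -> {RV P >-> bool})
    (m n K : nat) :
  0 < l <= 1 -> 0 < alpha <= 1 ->
  iid_bernoulli alpha B -> iid_bernoulli (alpha_ratio alpha l) D ->
  independent_sequences B D -> (m < K)%N ->
  ((ell_alpha alpha l ^+ m)%:E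
     * P [set w | (partial_sum B n w > partial_sum D m w)%N]
   = (half_coef alpha l m n K)%:E)%E.
Proof.
move=> hl ha hB hD hBD lt_mK.
have L0 : ell_alpha alpha l != 0.
  rewrite /ell_alpha gt_eqF //; case/andP: hl ha => l0 _ /andP[a0 a1].
  by rewrite ltr_wpDl ?subr_ge0 ?mulr_gt0.
have a01 : 0 <= alpha <= 1 by case/andP: ha => /ltW -> ->.
(* The sums are bounded by [m] and [n], so the pair takes values in a finite type and the event
   splits into its fibres. *)
pose g w : 'I_m.+1 * 'I_n.+1 :=
  (inord (partial_sum D m w), inord (partial_sum B n w)).
have g1 w : (g w).1 = partial_sum D m w :> nat.
  by rewrite inordK // ltnS partial_sum_le.
have g2 w : (g w).2 = partial_sum B n w :> nat.
  by rewrite inordK // ltnS partial_sum_le.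
have gE p : g @^-1` [set p] =
    partial_sum B n @^-1` [set (p.2 : nat)] `&`
    partial_sum D m @^-1` [set (p.1 : nat)].
  apply/seteqP; split=> [w /= <-|w /= [e2 e1]]; first by rewrite g1 g2.
  case: p e1 e2 => i j /= e1 e2.
  by congr pair; apply/val_inj; rewrite /= ?g1 ?g2.
have mS (X : nat -> {RV P >-> bool}) k A : measurable (partial_sum X k @^-1` A).
  apply: (@measurable_sum_bool _ _ (fun i => X i : T -> bool)) => i b.
  exact: measurable_funPTI.
have -> : [set w | (partial_sum D m w < partial_sum B n w)%N] =
    [set w | ((g w).1 < (g w).2)%N].
  by apply/seteqP; split=> w /=; rewrite g1 g2.
rewrite (probability_fintype _
  (fun p : 'I_m.+1 * 'I_n.+1 => p.1 < p.2)%N); last first.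
  by move=> p; rewrite gE; apply: measurableI.
under eq_bigr => p _.
  rewrite gE hBD; [|exact: sigma_of_partial_sum..].
  rewrite (partial_sum_law _ _ a01 hB).
  rewrite (partial_sum_law _ _ (alpha_ratio01 hl ha) hD).
  over.
rewrite sumEFin -EFinM; congr EFin.
rewrite -(pair_big_dep predT (fun (i : 'I_m.+1) (j : 'I_n.+1) => (i < j)%N)
  (fun i j => binomial_pmf n alpha j *
              binomial_pmf m (alpha_ratio alpha l) i)) /=.
rewrite /half_coef exchange_big_nat !mulr_sumr.
(* The indices [k > m] are dropped, as ['C(m, k)] is 0 there. *)
rewrite [RHS](big_cat_nat (n := m.+1)) //=.
rewrite [X in _ = _ + X]big_nat [X in _ = _ + X]big1 ?addr0; last first.
  move=> k /andP[lt_mk _]; rewrite big1 ?mulr0 // => j _.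
  by rewrite bin_small ?mul0r.
rewrite big_mkord; apply: eq_bigr => k _.
rewrite -mulr_suml.
have -> : \sum_(i < n.+1 | (k < i)%N) binomial_pmf n alpha i =
    \sum_(k.+1 <= i < n.+1) binomial_pmf n alpha i by rewrite big_geq_mkord.
rewrite binomial_tail mulrCA ell_alpha_binomial_pmf // -mulrA; congr (_ * _).
(* Reversing the sum matches the number of trials t with n - 1 - j. *)
rewrite big_nat_rev mulr_suml; apply: eq_big_nat => j /andP[_ lt_jn].
rewrite add0n.
have [lt_jk|le_kj] := ltnP (n - j.+1) k.
  by rewrite /binomial_pmf bin_small // mulr0n mulr0 !mul0r.
have le_km : (k <= m)%N by rewrite -ltnS.
(* The exponent counts the failures of both sequences; [le_kj] and [le_km] rule out truncation. *)
have -> : (n + m - 1 - j - 2 * k = (n - j.+1 - k) + (m - k))%N by lia.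
rewrite /binomial_pmf /unstable.onem -(mulr_natl _ 'C(n - _, k)).
rewrite -(mulr_natl _ 'C(m, k)) exprD !exprMn.
ring.
Qed.

Theorem proposition7 (R : realType) (d : measure_display)
    (T : measurableType d) (P : probability T R) (l alpha : R)
    (hl : 0 < l <= 1) (halpha : 0 < alpha <= 1)
    (B D : nat -> {RV P >-> bool})
    (hB : iid_bernoulli alpha B)
    (hD : iid_bernoulli (alpha_ratio alpha l) D)
    (hBD : independent_sequences B D)
    (m n : nat) (hmn : (m <= n)%N) :
  ((coef_c alpha l m n)%:E
   = (ell_alpha alpha l ^+ m)%:E
       * P [set w | (partial_sum B n w > partial_sum D m w)%N]
     - (ell_alpha alpha l ^+ n)%:E
       * P [set w | (partial_sum B m w > partial_sum D n w)%N])%E.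
Proof.
(* The bound [K = n.+1] exceeds both [m] and [n], so it serves both halves. *)
rewrite (coef_cE _ _ hmn (ltnSn n)) EFinB.
by rewrite !(@partial_sum_gt _ _ _ _ _ _ _ _ _ _ n.+1).
Qed.
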